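(* For every positive integer $n$, the number $\sigma(G_{n\times n})$ (the minimum number of sets in a c-sparse partition of the $n\times n$ checkerboard) equals the smallest natural number strictly greater than $\frac{n}{2}$.
   Context: For positive integers $n,m$, the $n\times m$ checkerboard $G_{n\times m}$ is the set of cells $(i,j)$ with $1\leq i\leq n$ and $1\leq j\leq m$. The cells are totally ordered by: $(i_1,j_1)<(i_2,j_2)$ iff either $i_1<i_2$, or $i_1=i_2$ and $j_1<j_2$. The second coordinate of a cell is called its $y$-coordinate. A subset $S$ of the cells of $G_{n\times m}$ is c-sparse if for any two cells $(a_1,b),(a_2,b)\in S$ with the same $y$-coordinate and any cell $(x,y)$ with $y\neq b$ and $(a_1,b)<(x,y)<(a_2,b)$, one has $(x,y)\notin S$. A partition $P$ of $G_{n\times m}$ is c-sparse if all the sets of the partition are c-sparse. Define $\sigma(G_{n\times m})=\min\{|P| : P \text{ is a c-sparse partition of } G_{n\times m}\}$. *)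

(* Defs.v *)
From HB Require Import structures.
From mathcomp Require Import all_boot all_order all_algebra.

Set Implicit Arguments.
Unset Strict Implicit.
Unset Printing Implicit Defensive.

(* Coordinates are numbered from 0, so the paper's cell (i, j) is
   (i - 1, j - 1) here; only their order and equality are ever used. *)
Notation cell n m := ('I_n * 'I_m)%type.

Section Checkerboard.
Variables n m : nat.
Implicit Types (c d : cell n m) (S : {set cell n m}).

Definition cell_lt c d : bool :=
  (c.1 < d.1) || (c.1 == d.1) && (c.2 < d.2).

Definition c_sparse S : bool :=
  [forall a1 : 'I_n, forall a2 : 'I_n, forall b : 'I_m,
    ((a1, b) \in S) && ((a2, b) \in S) ==>
    [forall x : 'I_n, forall y : 'I_m,
      [&& y != b, cell_lt (a1, b) (x, y) & cell_lt (x, y) (a2, b)] ==>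
      ((x, y) \notin S)]].

Definition c_sparse_partition (P : {set {set cell n m}}) : bool :=
  partition P [set: cell n m] && [forall S in P, c_sparse S].

Definition has_c_sparse_partition (k : nat) : bool :=
  [exists P, c_sparse_partition P && (#|P| == k)].

(* The partition into singletons is c-sparse, so the minimum exists. *)
Lemma ex_c_sparse_partition : exists k, has_c_sparse_partition k.
Proof.
pose P := preim_partition (@id (cell n m)) [set: cell n m].
exists #|P|; apply/existsP; exists P; rewrite eqxx andbT.
rewrite /c_sparse_partition preim_partitionP /=.
apply/forall_inP => S /imsetP[c _ ->].
apply/'forall_forallP => a1 a2; apply/forallP => b.
apply/implyP => /andP[]; rewrite !inE /= => /eqP Ec _.
apply/'forall_forallP => x y; apply/implyP => /and3P[yb _ _].
by rewrite inE inE /= Ec xpair_eqE negb_and [b == y]eq_sym yb orbT.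
Qed.

Definition sigma : nat := ex_minn ex_c_sparse_partition.

End Checkerboard.

(* Main.v *)
Require Import Defs.
From mathcomp Require Import all_boot all_order all_algebra.
From mathcomp Require Import zify.
Import Order.TTheory GRing.Theory Num.Theory.

(** Write [n] rows and [m] columns, the cells being read row by row.

    Lower bound.  In a c-sparse set, call a cell repeated if its column already
    holds a cell of the set in an earlier row.  The non-repeated cells lie in
    distinct columns.  The repeated cells lie in distinct rows: a second
    repeated cell further right in the same row, together with the earlier
    cell of its column, would enclose the first one.  As no cell of the top row
    is repeated, a c-sparse set has at most [m + (n - 1)] cells
    ([card_c_sparse]).  On the square board a partition into [k] c-sparse sets
    thus has [n ^ 2 <= k * (2 * n - 1)], which forces [n < 2 * k].

    Upper bound.  A pair of adjacent diagonals [y - x = 2c], [y - x = 2c + 1]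
    is a staircase, which leaves each column for good before entering the next
    one.  Above the main diagonal it uses the columns from [2c] on and ends in
    row [n - 1 - 2c].  The two diagonals [y - x = 2c - n], [y - x = 2c - n - 1]
    strictly below the main diagonal form a staircase that uses only columns
    before [2c] and starts in row [n - 2c]; it can therefore be appended, and
    the union is still c-sparse ([c_sparse_stair]).  Letting [c] range over
    [0, ..., n./2] exhausts the diagonals on both sides. *)

(** * At most m + n - 1 cells in a c-sparse set *)

Lemma c_sparseP n m (S : {set cell n m}) :
  reflect (forall (a1 a2 x : 'I_n) (b y : 'I_m),
             (a1, b) \in S -> (a2, b) \in S -> (x, y) \in S -> y != b ->
             cell_lt (a1, b) (x, y) -> ~~ cell_lt (x, y) (a2, b))
          (c_sparse S).
Proof.
apply: (iffP idP) => [spS a1 a2 x b y S1 S2 Sxy yb lt1 | spS].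
  move: spS => /'forall_forallP/(_ a1 a2)/forallP/(_ b); rewrite S1 S2 /=.
  by move=> /'forall_forallP/(_ x y); rewrite yb lt1 Sxy implybF.
apply/'forall_forallP => a1 a2; apply/forallP => b.
apply/implyP => /andP[S1 S2]; apply/'forall_forallP => x y.
apply/implyP => /and3P[yb lt1 lt2]; apply/negP => Sxy.
by move: (spS _ _ _ _ _ S1 S2 Sxy yb lt1); rewrite lt2.
Qed.

Definition repeated {n m} (S : {set cell n m}) : {set cell n m} :=
  [set c in S | [exists a : 'I_n, (a < c.1) && ((a, c.2) \in S)]].

Lemma snd_inj_nonrepeated n m (S : {set cell n m}) :
  {in S :\: repeated S &, injective snd}.
Proof.
move=> [a b] [a' b'] /setDP[Sc rc] /setDP[Sc' rc'] /= Eb; subst b'.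
have [lt|lt|/val_inj-> //] := ltngtP a a'.
  by case/negP: rc'; rewrite inE Sc'; apply/existsP; exists a; rewrite lt.
by case/negP: rc; rewrite inE Sc; apply/existsP; exists a'; rewrite lt.
Qed.

(** Of two cells of [S] in one row, the left one is read between the right one
    and any earlier cell in the column of the right one. *)
Lemma fst_inj_repeated n m (S : {set cell n m}) :
  c_sparse S -> {in repeated S &, injective fst}.
Proof.
move=> /c_sparseP spS.
have no_left (a : 'I_n) (b b' : 'I_m) :
    (a, b) \in S -> (a, b') \in repeated S -> ~~ (b < b').
  move=> Sb; rewrite inE => /andP[Sb' /existsP[a1 /andP[/= lt1 S1]]].
  apply/negP => lt; have := spS _ _ _ _ _ S1 Sb' Sb.
  by rewrite /cell_lt /= lt1 eqxx lt orbT neq_ltn lt => /(_ isT isT).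
move=> [a b] [a' b'] rc rc' /= Ea; subst a'; congr pair; apply: val_inj.
have [Sc Sc'] : (a, b) \in S /\ (a, b') \in S.
  by move: rc rc'; rewrite !inE => /andP[-> _] /andP[-> _].
move: (no_left _ _ _ Sc rc') (no_left _ _ _ Sc' rc); rewrite -!leqNgt => le le'.
by apply/eqP; rewrite eqn_leq le' le.
Qed.

Lemma card_c_sparse n m (S : {set cell n.+1 m}) :
  c_sparse S -> #|S| <= m + n.
Proof.
move=> spS; have /setIidPr Srep : repeated S \subset S.
  by apply/subsetP => c; rewrite inE => /andP[].
rewrite -(cardsID (repeated S) S) Srep addnC leq_add //.
  rewrite -(card_in_imset (@snd_inj_nonrepeated _ _ S)).
  by rewrite (leq_trans (max_card _)) ?card_ord.
rewrite -(card_in_imset (fst_inj_repeated _ _ _ spS)).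
apply: (@leq_trans #|[set~ (ord0 : 'I_n.+1)]|); last by rewrite cardsC1 card_ord.
apply/subset_leq_card/subsetP => _ /imsetP[c + ->].
case/setIdP=> _ /existsP[a /andP[lt _]].
by rewrite !inE -val_eqE -lt0n (leq_ltn_trans _ lt).
Qed.

Lemma c_sparse_partition_lb n (P : {set {set cell n n}}) :
  0 < n -> c_sparse_partition P -> n < #|P|.*2.
Proof.
case: n P => // n P _ /andP[partP /forall_inP spP].
have := card_partition partP; rewrite cardsT card_prod card_ord => cardE.
have : n.+1 * n.+1 <= #|P| * (n.+1 + n).
  rewrite cardE -sum_nat_const; apply: leq_sum => S PS.
  exact: card_c_sparse (spP S PS).
nia.
Qed.

(** * A partition into staircases *)

Definition stair n (c : cell n n) : nat :=
  if c.1 <= c.2 then (c.2 - c.1)./2 else (n.+1 - (c.1 - c.2))./2.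

Lemma stair_bound n (c : cell n n) : stair n c <= n./2.
Proof.
by case: c => x y; rewrite /stair /=; have := ltn_ord y; case: (leqP x y); lia.
Qed.

(** Two cells of the set in one column are in consecutive rows, on both of the
    adjacent diagonals of one staircase.  A cell read between them is to the
    right of the upper one or to the left of the lower one, hence on a diagonal
    outside that staircase; its diagonal does not belong to the other staircase
    either, which is [n] diagonals away, farther than a row reaches. *)
Lemma c_sparse_stair n k : c_sparse [set c | stair n c == k].
Proof.
apply/c_sparseP => a1 a2 x b y; rewrite !inE /stair /cell_lt /= -!val_eqE /=.
have := (ltn_ord a1, ltn_ord a2, ltn_ord x, ltn_ord b, ltn_ord y).
move=> [] [] [] [].
by case: (leqP a1 b); case: (leqP a2 b); case: (leqP x y); lia.
Qed.

Lemma sigma_square_ub n : sigma n n <= n./2.+1.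
Proof.
pose f (c : cell n n) : 'I_n./2.+1 := inord (stair n c).
have fE c : f c = stair n c :> nat by rewrite inordK // ltnS stair_bound.
pose P := preim_partition f [set: cell n n].
have PE : P \subset [set [set c | stair n c == k] | k : 'I_n./2.+1].
  apply/subsetP => _ /imsetP[c _ ->]; apply/imsetP; exists (f c) => //.
  by apply/setP => d; rewrite !inE /= -val_eqE /= !fE eq_sym.
have cardP : #|P| <= n./2.+1.
  apply: leq_trans (subset_leq_card PE) _.
  by rewrite (leq_trans (leq_imset_card _ _)) // card_ord.
rewrite /sigma; case: ex_minnP => s _ min_s; apply: leq_trans cardP.
apply: min_s; apply/existsP; exists P; rewrite eqxx andbT.
rewrite /c_sparse_partition preim_partitionP /=.
apply/forall_inP => S /(subsetP PE)/imsetP[k _ ->]; exact: c_sparse_stair.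
Qed.

Lemma sigma_square_lb n : 0 < n -> n < (sigma n n).*2.
Proof.
move=> n_gt0; rewrite /sigma.
case: ex_minnP => s /existsP[P /andP[spP /eqP <-]] _.
exact: c_sparse_partition_lb.
Qed.

Local Open Scope ring_scope.

Lemma ltr_half_nat (n k : nat) : ((n%:R / 2 : rat) < k%:R) = (n < k.*2)%N.
Proof. by rewrite ltr_pdivrMr // -natrM ltr_nat muln2. Qed.

Theorem theorem2p1 (n : nat) (n_gt0 : (0 < n)%N) :
  (n%:R / 2 : rat) < (sigma n n)%:R /\
  (forall k : nat, (n%:R / 2 : rat) < k%:R -> (sigma n n <= k)%N).
Proof.
split=> [|k]; rewrite ltr_half_nat; first exact: sigma_square_lb.
move=> lt_nk; apply: leq_trans (sigma_square_ub n) _; lia.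
Qed.
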